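(* Let $$H_k=I-\sum_{i=1}^k\alpha_iv_iv_i^T,\qquad\alpha_i=1-\frac{\theta}{\lambda_i},$$ where $\theta>0$, $\lambda_1\ge\cdots\ge\lambda_k>0$, and $v_1,\dots,v_k\in\mathbb{R}^n$ are orthonormal. Suppose the eigenvectors and eigenvalues are perturbed such that $$\widehat v_i=v_i+\Delta v_i,\qquad\widehat\lambda_i=\lambda_i+\Delta\lambda_i>0,$$ with $$\|v_i\|=\|\widehat v_i\|=1,\qquad\|\Delta v_i\|=\tau_i,\qquad\left|\frac{\Delta\lambda_i}{\lambda_i}\right|=\zeta_i,\qquad i=1,\dots,k,$$ and define $$\widehat\alpha_i=1-\frac{\theta}{\widehat\lambda_i},\qquad\widehat H_k=I-\sum_{i=1}^k\widehat\alpha_i\widehat v_i\widehat v_i^T.$$ Then for any $y\in\mathbb{R}^n$ such that $H_ky\ne0$, $$\frac{\|(\widehat H_k-H_k)y\|}{\|H_ky\|}\le C(\theta)\sum_{i=1}^k\left(\frac{\theta\zeta_i}{\widehat\lambda_i}+w_i\left|1-\frac{\theta}{\widehat\lambda_i}\right|\right),$$ where $w_i=2\tau_i+\tau_i^2$, $i=1,\dots,k$, and $$C(\theta)=\begin{cases}1,&\theta\ge\lambda_1,\\[1ex]\dfrac{\lambda_1}{\theta},&0<\theta<\lambda_1.\end{cases}$$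
   Context: $\|\cdot\|$ denotes the Euclidean norm on vectors. In the paper $(\lambda_i,v_i)$, $i=1,\dots,k$, are the $k$ dominant eigenpairs (largest eigenvalues, orthonormal eigenvectors) of a symmetric positive definite matrix $A\in\mathbb{R}^{n\times n}$, and $H_k$ is the spectral limited-memory preconditioner with cluster point $\theta$. *)

(* Defs.v *)
From mathcomp Require Import all_boot all_order all_algebra.
From mathcomp Require Import reals.

Set Implicit Arguments.
Unset Strict Implicit.
Unset Printing Implicit Defensive.

Import Order.TTheory GRing.Theory Num.Theory.

Local Open Scope ring_scope.

(* The norm `|x| that MathComp-Analysis puts on matrices is the maximum norm,
   so the Euclidean norm needs its own definition. *)
Definition enorm (R : realType) (n : nat) (x : 'cV[R]_n) : R :=
  Num.sqrt (\sum_(j < n) x j 0 ^+ 2).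

Definition dotv (R : realType) (n : nat) (x y : 'cV[R]_n) : R :=
  \sum_(j < n) x j 0 * y j 0.

Definition orthonormal_family (R : realType) (n k : nat)
    (v : 'I_k -> 'cV[R]_n) : Prop :=
  forall i j : 'I_k, dotv (v i) (v j) = (i == j)%:R.

Definition alpha (R : realType) (theta lambda : R) : R := 1 - theta / lambda.

(* Spectral limited-memory preconditioner with cluster point theta. No condition
   on v is built in, since it is also used with perturbed, not necessarily
   orthogonal, vectors. *)
Definition slmp (R : realType) (n k : nat) (theta : R) (lambda : 'I_k -> R)
    (v : 'I_k -> 'cV[R]_n) : 'M[R]_n :=
  1%:M - \sum_(i < k) alpha theta (lambda i) *: (v i *m (v i)^T).

Definition bound_const (R : realType) (theta lambda1 : R) : R :=
  if lambda1 <= theta then 1 else lambda1 / theta.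

(* Main.v *)
Require Import Defs.
From mathcomp Require Import all_boot all_order all_algebra.
From mathcomp Require Import reals.
From mathcomp Require Import ring lra.

(** Write [z = H y], where [H] is the exact preconditioner. The bound is the
    product of two estimates that meet at the norm of [y].

    Forward perturbation ([enorm_slmpB]): the difference of the two
    preconditioners is a sum of [k] terms, each of which splits as
      (alpha_i - alphah_i) v_i v_i^T + alphah_i (v_i v_i^T - vh_i vh_i^T).
    The coefficient of the first part is theta (lambda_i - lambdah_i) /
    (lambda_i lambdah_i), of absolute value theta zeta_i / lambdah_i, and the
    difference of rank-one projectors has norm at most 2 tau_i + tau_i^2
    ([enorm_outerB]). The triangle inequality then bounds the norm of
    [(Hh - H) y] by the sum in the statement times the norm of [y].

    Inverse bound ([enorm_le_slmp]): [H] multiplies each [v_i] by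
    [theta / lambda_i] and fixes the orthogonal complement of their span, so its
    inverse has norm at most max (1, lambda_1 / theta), and the norm of [y] is
    at most this constant times the norm of [z]. This is proved without
    inverting [H], by comparing the orthogonal decompositions of [y] and [z] along the [v_i]
    with the Pythagorean identity ([dotv_pythagoras]). *)

Set Implicit Arguments.
Unset Strict Implicit.
Unset Printing Implicit Defensive.

Import Order.TTheory GRing.Theory Num.Theory.

Local Open Scope ring_scope.

(** * Euclidean geometry of column vectors *)

Lemma dotvC (R : realType) (n : nat) (x y : 'cV[R]_n) : dotv x y = dotv y x.
Proof. by apply: eq_bigr => j _; rewrite mulrC. Qed.

Lemma dotvDl (R : realType) (n : nat) (x y z : 'cV[R]_n) :
  dotv (x + y) z = dotv x z + dotv y z.
Proof. by rewrite -big_split; apply: eq_bigr => j _; rewrite mxE mulrDl. Qed.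

Lemma dotvZl (R : realType) (n : nat) (a : R) (x y : 'cV[R]_n) :
  dotv (a *: x) y = a * dotv x y.
Proof. by rewrite mulr_sumr; apply: eq_bigr => j _; rewrite mxE mulrA. Qed.

Lemma dotvDr (R : realType) (n : nat) (x y z : 'cV[R]_n) :
  dotv x (y + z) = dotv x y + dotv x z.
Proof. by rewrite dotvC dotvDl !(dotvC x). Qed.

Lemma dotvZr (R : realType) (n : nat) (a : R) (x y : 'cV[R]_n) :
  dotv x (a *: y) = a * dotv x y.
Proof. by rewrite dotvC dotvZl dotvC. Qed.

Lemma dotv0l (R : realType) (n : nat) (x : 'cV[R]_n) : dotv 0 x = 0.
Proof. by rewrite -(scale0r 0) dotvZl mul0r. Qed.

Lemma dotv_sumr (R : realType) (n k : nat) (x : 'cV[R]_n)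
    (f : 'I_k -> 'cV[R]_n) :
  dotv x (\sum_i f i) = \sum_i dotv x (f i).
Proof.
apply: (big_morph (dotv x)) => [u u'|]; first exact: dotvDr.
by rewrite dotvC dotv0l.
Qed.

Lemma dotv_ge0 (R : realType) (n : nat) (x : 'cV[R]_n) : 0 <= dotv x x.
Proof. by apply: sumr_ge0 => j _; rewrite -expr2 sqr_ge0. Qed.

Lemma dotv_eq0 (R : realType) (n : nat) (x : 'cV[R]_n) :
  (dotv x x == 0) = (x == 0).
Proof.
apply/idP/eqP => [|->]; last by rewrite dotv0l.
rewrite psumr_eq0 => [/allP x0|j _]; last by rewrite -expr2 sqr_ge0.
apply/matrixP => j o; rewrite (ord1 o) mxE; apply/eqP.
by have := x0 j (mem_index_enum j); rewrite /= -expr2 sqrf_eq0.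
Qed.

Lemma enormE (R : realType) (n : nat) (x : 'cV[R]_n) :
  enorm x = Num.sqrt (dotv x x).
Proof. by congr (Num.sqrt _); apply: eq_bigr => j _; rewrite expr2. Qed.

Lemma enorm_ge0 (R : realType) (n : nat) (x : 'cV[R]_n) : 0 <= enorm x.
Proof. exact: sqrtr_ge0. Qed.

Lemma sqr_enorm (R : realType) (n : nat) (x : 'cV[R]_n) :
  enorm x ^+ 2 = dotv x x.
Proof. by rewrite enormE sqr_sqrtr // dotv_ge0. Qed.

Lemma enorm_gt0 (R : realType) (n : nat) (x : 'cV[R]_n) :
  (0 < enorm x) = (x != 0).
Proof. by rewrite enormE sqrtr_gt0 lt_def dotv_ge0 andbT dotv_eq0. Qed.

Lemma enorm0 (R : realType) (n : nat) : enorm (0 : 'cV[R]_n) = 0.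
Proof. by rewrite enormE dotv0l sqrtr0. Qed.

Lemma enormZ (R : realType) (n : nat) (a : R) (x : 'cV[R]_n) :
  enorm (a *: x) = `|a| * enorm x.
Proof.
by rewrite !enormE dotvZl dotvZr mulrA -expr2 sqrtrM ?sqr_ge0 // sqrtr_sqr.
Qed.

Lemma enormN (R : realType) (n : nat) (x : 'cV[R]_n) : enorm (- x) = enorm x.
Proof. by rewrite -scaleN1r enormZ normrN1 mul1r. Qed.

Lemma cauchy_schwarz (R : realType) (n : nat) (x y : 'cV[R]_n) :
  `|dotv x y| <= enorm x * enorm y.
Proof.
have [->|y0] := eqVneq y 0; first by rewrite dotvC dotv0l normr0 enorm0 mulr0.
have yy_gt0 : 0 < dotv y y by rewrite lt_def dotv_eq0 y0 dotv_ge0.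
have xy_ge0 : 0 <= enorm x * enorm y by rewrite mulr_ge0 ?enorm_ge0.
rewrite -(ler_sqr (normr_ge0 _) xy_ge0) -normrX ger0_norm ?sqr_ge0 //.
rewrite exprMn !sqr_enorm -subr_ge0 -(pmulr_rge0 _ yy_gt0).
(* The square of [y . y] times the component of [x] orthogonal to [y]. *)
have := dotv_ge0 (dotv y y *: x + (- dotv x y) *: y).
rewrite !(dotvDl, dotvDr, dotvZl, dotvZr) (dotvC y x).
by congr (0 <= _); ring.
Qed.

Lemma ler_enormD (R : realType) (n : nat) (x y : 'cV[R]_n) :
  enorm (x + y) <= enorm x + enorm y.
Proof.
have xy_ge0 : 0 <= enorm x + enorm y by rewrite addr_ge0 ?enorm_ge0.
rewrite -(ler_sqr (enorm_ge0 _) xy_ge0) sqrrD !sqr_enorm.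
rewrite !(dotvDl, dotvDr) (dotvC y x).
have := le_trans (ler_norm _) (cauchy_schwarz x y).
lra.
Qed.

Lemma ler_enorm_sum (R : realType) (n k : nat) (f : 'I_k -> 'cV[R]_n) :
  enorm (\sum_i f i) <= \sum_i enorm (f i).
Proof.
elim/big_ind2: _ => [|a x b y xa yb|//]; first by rewrite enorm0.
exact: le_trans (ler_enormD x y) (lerD xa yb).
Qed.

(** * Rank-one matrices *)

Lemma outer_mulmx (R : realType) (n : nat) (v y : 'cV[R]_n) :
  (v *m v^T) *m y = dotv v y *: v.
Proof.
rewrite -mulmxA; apply/matrixP => j o.
rewrite (ord1 o) !mxE big_ord1 mulrC mxE; congr (_ * _).
by apply: eq_bigr => l _; rewrite mxE.
Qed.

(** With [vh = v + d], the difference of the projectors is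
    [- (d v^T + v d^T + d d^T)]: two terms linear in [d] and a quadratic one. *)
Lemma enorm_outerB (R : realType) (n : nat) (v d y : 'cV[R]_n) :
  enorm v = 1 ->
  enorm (dotv v y *: v - dotv (v + d) y *: (v + d))
    <= (2 * enorm d + enorm d ^+ 2) * enorm y.
Proof.
move=> v1.
have -> : dotv v y *: v - dotv (v + d) y *: (v + d)
    = - (dotv v y *: d + dotv d y *: v + dotv d y *: d).
  rewrite dotvDl; apply/matrixP => i j; rewrite !mxE; ring.
rewrite enormN; apply: le_trans (ler_enormD _ _) _.
apply: le_trans (lerD (ler_enormD _ _) (lexx _)) _.
rewrite !enormZ v1 mulr1.
have vy := cauchy_schwarz v y; rewrite v1 mul1r in vy.
have dy := cauchy_schwarz d y.
have := lerD (lerD (ler_wpM2r (enorm_ge0 d) vy) dy)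
             (ler_wpM2r (enorm_ge0 d) dy).
by move/le_trans; apply; rewrite le_eqVlt; apply/orP; left; apply/eqP; ring.
Qed.

(** * The preconditioner *)

Lemma slmp_mulmx (R : realType) (n k : nat) (theta : R) (lambda : 'I_k -> R)
    (v : 'I_k -> 'cV[R]_n) (y : 'cV[R]_n) :
  slmp theta lambda v *m y
    = y - \sum_i (alpha theta (lambda i) * dotv (v i) y) *: v i.
Proof.
rewrite /slmp mulmxBl mul1mx mulmx_suml; congr (_ - _).
by apply: eq_bigr => i _; rewrite -scalemxAl outer_mulmx scalerA.
Qed.

Lemma dotv_pythagoras (R : realType) (n k : nat) (v : 'I_k -> 'cV[R]_n)
    (a : 'I_k -> R) (r : 'cV[R]_n) :
  orthonormal_family v -> (forall i, dotv (v i) r = 0) ->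
  dotv (r + \sum_i a i *: v i) (r + \sum_i a i *: v i)
    = dotv r r + \sum_i a i ^+ 2.
Proof.
move=> vON vr0; set s := \sum_i _.
have vs i : dotv (v i) s = a i.
  rewrite dotv_sumr (bigD1 i) //= dotvZr vON eqxx mulr1 big1 ?addr0 // => j ji.
  by rewrite dotvZr vON eq_sym (negbTE ji) mulr0.
have sr : dotv s r = 0.
  by rewrite dotvC dotv_sumr big1 // => i _; rewrite dotvZr dotvC vr0 mulr0.
rewrite dotvDl !dotvDr (dotvC r s) sr addr0 add0r; congr (_ + _).
rewrite {2}/s dotv_sumr; apply: eq_bigr => i _.
by rewrite dotvZr dotvC vs expr2.
Qed.

(** The component of [y] orthogonal to the [v_i] is unchanged by the
    preconditioner and the one along [v_i] is multiplied by [theta / lambda_i],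
    so any [C] that dominates both [1] and all the [lambda_i / theta] bounds the
    norm of the inverse. *)
Lemma enorm_le_slmp (R : realType) (n k : nat) (theta C : R)
    (lambda : 'I_k -> R) (v : 'I_k -> 'cV[R]_n) (y : 'cV[R]_n) :
  orthonormal_family v -> 1 <= C -> (forall i, 1 <= C * (theta / lambda i)) ->
  enorm y <= C * enorm (slmp theta lambda v *m y).
Proof.
move=> vON C1 Cl.
have C0 : 0 <= C by rewrite (le_trans ler01).
rewrite -(ler_sqr (enorm_ge0 _) (mulr_ge0 C0 (enorm_ge0 _))) exprMn !sqr_enorm.
rewrite slmp_mulmx.
pose c i := dotv (v i) y.
pose r := y - \sum_i c i *: v i.
have vr0 i : dotv (v i) r = 0.
  rewrite /r -scaleN1r dotvDr dotvZr dotv_sumr (bigD1 i) //= dotvZr vON eqxx.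
  rewrite big1 => [|j ji]; first by rewrite mulr1 addr0 mulN1r subrr.
  by rewrite dotvZr vON eq_sym (negbTE ji) mulr0.
have -> : y - \sum_i (alpha theta (lambda i) * dotv (v i) y) *: v i
    = r + \sum_i (theta / lambda i * c i) *: v i.
  rewrite /r -addrA; congr (_ + _); rewrite -!sumrN -big_split.
  apply: eq_bigr => i _ /=; rewrite -!scaleNr -scalerDl /alpha /c.
  by congr (_ *: _); ring.
have {1 2}-> : y = r + \sum_i c i *: v i by rewrite /r subrK.
rewrite !dotv_pythagoras // mulrDr; apply: lerD.
  by rewrite ler_peMl ?dotv_ge0 // exprn_ege1.
rewrite mulr_sumr; apply: ler_sum => i _; rewrite -exprMn mulrA exprMn.
by rewrite ler_peMl ?sqr_ge0 // exprn_ege1.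
Qed.

Lemma bound_const_ge1 (R : realType) (theta lambda1 : R) :
  0 < theta -> 1 <= bound_const theta lambda1.
Proof.
move=> t0; rewrite /bound_const; case: (leP lambda1) => // /ltW tl.
by rewrite ler_pdivlMr ?mul1r.
Qed.

Lemma bound_const_ge (R : realType) (theta lambda1 l : R) :
  0 < theta -> 0 < l -> l <= lambda1 ->
  1 <= bound_const theta lambda1 * (theta / l).
Proof.
move=> t0 l0 ll; rewrite mulrA ler_pdivlMr // mul1r /bound_const.
case: (leP lambda1) => [lt|_]; first by rewrite mul1r (le_trans ll).
by rewrite divfK ?gt_eqF.
Qed.

(** In each summand the eigenvalue changes on the exact projector and the
    eigenvector changes under the perturbed coefficient. This order of the two
    replacements is why the second part of the bound carries the weight
    [1 - theta / lambdah i]. *)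
Lemma enorm_slmpB (R : realType) (n k : nat) (theta : R)
    (lambda lambdah : 'I_k -> R) (v d : 'I_k -> 'cV[R]_n) (y : 'cV[R]_n) :
  0 < theta -> (forall i, 0 < lambda i) -> (forall i, 0 < lambdah i) ->
  (forall i, enorm (v i) = 1) ->
  enorm ((slmp theta lambdah (fun i => v i + d i) - slmp theta lambda v) *m y)
    <= (\sum_i (theta * `|(lambdah i - lambda i) / lambda i| / lambdah i
                + (2 * enorm (d i) + enorm (d i) ^+ 2)
                  * `|1 - theta / lambdah i|)) * enorm y.
Proof.
move=> t0 l0 lh0 v1; rewrite mulmxBl !slmp_mulmx.
rewrite opprB addrC addrA subrK -sumrB mulr_suml.
apply: le_trans (ler_enorm_sum _) _; apply: ler_sum => i _.
have -> : (alpha theta (lambda i) * dotv (v i) y) *: v i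
      - (alpha theta (lambdah i) * dotv (v i + d i) y) *: (v i + d i)
    = ((alpha theta (lambda i) - alpha theta (lambdah i)) * dotv (v i) y) *: v i
      + alpha theta (lambdah i)
        *: (dotv (v i) y *: v i - dotv (v i + d i) y *: (v i + d i)).
  by apply/matrixP => a b; rewrite !mxE; ring.
apply: le_trans (ler_enormD _ _) _; rewrite !enormZ v1 mulr1 normrM mulrDl.
have -> : `|alpha theta (lambda i) - alpha theta (lambdah i)|
    = theta * `|(lambdah i - lambda i) / lambda i| / lambdah i.
  rewrite -{3}(gtr0_norm t0) -{3}(gtr0_norm (lh0 i)) -normfV -!normrM -normrN.
  congr `|_|; rewrite /alpha; field.
  by rewrite !gt_eqF.
apply: lerD.
  rewrite ler_wpM2l ?divr_ge0 ?mulr_ge0 ?normr_ge0 ?(ltW t0) ?(ltW (lh0 i)) //.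
  by have := cauchy_schwarz (v i) y; rewrite v1 mul1r.
rewrite (mulrC _ `|1 - _|) -mulrA ler_wpM2l ?normr_ge0 //.
exact: enorm_outerB.
Qed.

Theorem corollary3p7 (R : realType) (n k : nat) (k_gt0 : (0 < k)%N)
    (theta : R) (lambda dlambda lambdah zeta tau w : 'I_k -> R)
    (v dv vh : 'I_k -> 'cV[R]_n) :
  0 < theta ->
  (forall i j : 'I_k, (i <= j)%N -> lambda j <= lambda i) ->
  (forall i : 'I_k, 0 < lambda i) ->
  orthonormal_family v ->
  (forall i : 'I_k, vh i = v i + dv i) ->
  (forall i : 'I_k, lambdah i = lambda i + dlambda i) ->
  (forall i : 'I_k, 0 < lambdah i) ->
  (forall i : 'I_k, enorm (v i) = 1) ->
  (forall i : 'I_k, enorm (vh i) = 1) ->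
  (forall i : 'I_k, enorm (dv i) = tau i) ->
  (forall i : 'I_k, `|dlambda i / lambda i| = zeta i) ->
  (forall i : 'I_k, w i = 2 * tau i + tau i ^+ 2) ->
  forall y : 'cV[R]_n,
    slmp theta lambda v *m y != 0 ->
    enorm ((slmp theta lambdah vh - slmp theta lambda v) *m y)
      / enorm (slmp theta lambda v *m y)
    <= bound_const theta (lambda (Ordinal k_gt0)) *
       \sum_(i < k) (theta * zeta i / lambdah i
                     + w i * `|1 - theta / lambdah i|).
Proof.
move=> t0 lmono l0 vON vhE lhE lh0 v1 _ dvE zE wE y Hy0.
have -> : slmp theta lambdah vh = slmp theta lambdah (fun i => v i + dv i).
  by congr (_ - _); apply: eq_bigr => i _; rewrite vhE.
rewrite ler_pdivrMr ?enorm_gt0 // mulrAC mulrC.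
set S := \sum_i _.
have SE : S = \sum_i (theta * `|(lambdah i - lambda i) / lambda i| / lambdah i
    + (2 * enorm (dv i) + enorm (dv i) ^+ 2) * `|1 - theta / lambdah i|).
  apply: eq_bigr => i _.
  have -> : lambdah i - lambda i = dlambda i by rewrite lhE addrC addKr.
  by rewrite wE dvE zE.
have S0 : 0 <= S.
  rewrite SE; apply: sumr_ge0 => i _.
  by rewrite addr_ge0 ?mulr_ge0 ?addr_ge0 ?mulr_ge0 ?invr_ge0 ?sqr_ge0
             ?enorm_ge0 ?normr_ge0 ?ltW.
apply: le_trans (enorm_slmpB dv y t0 l0 lh0 v1) _; rewrite -SE ler_wpM2l //.
apply: enorm_le_slmp => //; first exact: bound_const_ge1.
by move=> i; apply: bound_const_ge => //; apply: lmono.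
Qed.
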